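(* Let $\mathcal{G}=(\mathcal{N},\mathcal{E})$ be the velocity graph whose edges are minimum-time trajectories of an input-constrained double integrator, and let $\mathcal{G}_{mp}=(\mathcal{N}_{mp},\mathcal{E}_{mp})$ be a motion primitive graph over the same waypoints and sampled velocities whose edges are solutions of optimal control problems of the form $$\min_{T,\,u}\ J=\rho\,T+\int_0^T q(r,v,\dots,u)\,dt$$ subject to $r^{(p)}=u$, $c(a)\le 0$, prescribed initial values $r(0),v(0),\dots,r^{(p-1)}(0)$, prescribed terminal $r(T)=r_f$, $v(T)=v_f$, and $r^{(k-1)}(T)$ free for $3\le k\le p$, where $p\ge 2$, $q$ is positive definite and $\rho>1$. Assume that in each axis the double integrator input bound $u_{\max}$ is the maximum possible acceleration achievable in that axis under $c(a)\le 0$. For $n\in\mathcal{N}_{mp}$ let $h(n)=V_d^*(n)$ be the optimal cost-to-go, in the velocity graph $\mathcal{G}$, of the node of $\mathcal{G}$ having the same waypoint and velocity as $n$. Then $h$ is an admissible heuristic for the search over $\mathcal{G}_{mp}$: for all $n\in\mathcal{N}_{mp}$, $$h(n)\le h^*(n),$$ where $h^*(n)=V_{mp}^*(n)$ is the optimal cost in $\mathcal{G}_{mp}$ from $n$ to the goal.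
   Context: Notation: $r(t)\in\mathbb{R}^3$ is position, $v=\dot r$, $a=\ddot r$. Velocity graph $\mathcal{G}$: given ordered waypoints $w_1,\dots,w_N\in\mathbb{R}^3$, with a finite set of sampled velocities at each intermediate waypoint and a single prescribed velocity at $w_1$ (start) and at $w_N$ (goal), the nodes are the (waypoint, velocity) pairs, nodes at different waypoint indices being different; there is one directed edge from each node at $w_i$ to each node at $w_{i+1}$, $1\le i\le N-1$. The cost of an edge is $T_d^*$, the minimum time $T$ for which there is a trajectory from the first position-velocity state to the second satisfying $\ddot r=u$, $|u_i|\le u_{i,\max}$ in each axis $i$ (where $u_{i,\max}$ denotes $u_{\max}$ in axis $i$). The optimal cost-to-go $V_d^*$ of a node is the minimum, over paths in $\mathcal{G}$ from that node to the goal node, of the sum of edge costs (0 at the goal); equivalently it satisfies the Bellman equation $V_d^*(n)=\min_{e}\big[\ell(n,e)+V_d^*(\phi(n,e))\big]$ at non-goal nodes, with $\ell(n,e)=T_d^*$ of the edge $e$ leaving $n$ and $\phi(n,e)$ the node reached. Motion primitive graph $\mathcal{G}_{mp}$: nodes correspond to state vectors (position, velocity, and derivatives up to order $p-1$) located at waypoints, whose position and velocity components form a node of $\mathcal{G}$. Each edge goes from a node at $w_i$ to a node at $w_{i+1}$ and is a motion primitive, i.e. a solution of the optimal control problem in the claim whose initial values are the state of the first node and whose prescribed terminal position and velocity are those of the second node; the edge cost is the optimal value of $J$. Some candidate edges may be absent (e.g. removed for collision or constraint violation). Goal nodes are the nodes with waypoint $w_N$ and the prescribed goal velocity. $V_{mp}^*(n)$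 is the minimum, over paths in $\mathcal{G}_{mp}$ from $n$ to a goal node, of the sum of edge costs (0 at a goal node, $+\infty$ if no path exists). The function $c$ encodes the acceleration constraint; $u_{i,\max}$ is the (finite, positive) maximum of $|a_i|$ over $a\in\mathbb{R}^3$ with $c(a)\le 0$. Inputs are measurable functions, with bounds holding for almost every time. The function $q$ is real-valued and positive definite, in particular nonnegative. Admissible heuristic: a function $h$ on the nodes is admissible if $h(n)\le h^*(n)$ for all nodes $n$, where $h^*(n)$ is the optimal cost from $n$ to the goal. *)

(* Defs.v *)
From HB Require Import structures.
From mathcomp Require Import all_boot all_order all_algebra finmap.
From mathcomp Require Import all_classical all_reals all_analysis.

Set Implicit Arguments.
Unset Strict Implicit.
Unset Printing Implicit Defensive.

Import Order.TTheory GRing.Theory Num.Theory.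
Local Open Scope classical_set_scope.
Local Open Scope ring_scope.

Record wgraph (R : realType) : Type := WGraph {
  node : Type;
  edge : Type;
  src : edge -> node;
  tgt : edge -> node;
  cost : edge -> \bar R }.

Fixpoint walk (R : realType) (G : wgraph R) (n : node G) (s : seq (edge G))
    (m : node G) : Prop :=
  if s is e :: s' then src e = n /\ walk (tgt e) s' m else n = m.

(* The empty walk has cost 0, so a goal node gets at most 0; a node from which
   no goal is reachable gets +oo. *)
Definition cost_to_go (R : realType) (G : wgraph R) (goal : set (node G))
    (n : node G) : \bar R :=
  ereal_inf [set (\sum_(e <- s) cost e)%E
            | s in [set s | exists2 m, goal m & walk n s m]].

Definition admissible (R : realType) (G : wgraph R) (goal : set (node G))
    (h : node G -> \bar R) : Prop :=
  forall n : node G, (h n <= cost_to_go goal n)%E.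

(* Caratheodory sense: f' = g on [0, T], with f absolutely continuous and g
   (measurable and) integrable. *)
Definition integrates (R : realType) (T : R) (f g : R -> 'rV[R]_3) : Prop :=
  forall i : 'I_3,
    (@lebesgue_measure R).-integrable `[0, T]
      (fun t => (g t ord0 i)%:E) /\
    forall t : R, 0 <= t <= T ->
      f t ord0 i = f 0 ord0 i +
        \int[@lebesgue_measure R]_(s in `[0, t]) g s ord0 i.

(* r k stands for the k-th derivative of the position; the input is u = r p,
   and the values r k with k > p are irrelevant. *)
Definition integrator_chain (R : realType) (p : nat) (T : R)
    (r : nat -> R -> 'rV[R]_3) : Prop :=
  forall k : nat, (k < p)%N -> integrates T (r k) (r k.+1).

Definition ae_on (R : realType) (T : R) (P : R -> Prop) : Prop :=
  {ae @lebesgue_measure R, forall t : R, 0 <= t <= T -> P t}.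

Definition di_reachable (R : realType) (umax : 'rV[R]_3)
    (r0 v0 r1 v1 : 'rV[R]_3) (T : R) : Prop :=
  0 <= T /\
  exists r : nat -> R -> 'rV[R]_3,
    [/\ integrator_chain 2 T r,
        ae_on T (fun t => forall i : 'I_3, `|r 2%N t ord0 i| <= umax ord0 i),
        r 0%N 0 = r0 /\ r 1%N 0 = v0 &
        r 0%N T = r1 /\ r 1%N T = v1].

Definition min_time (R : realType) (umax : 'rV[R]_3)
    (r0 v0 r1 v1 : 'rV[R]_3) : \bar R :=
  ereal_inf [set T%:E | T in di_reachable umax r0 v0 r1 v1].

(* The waypoints w_1, ..., w_N are indexed by 'I_nseg.+1, with N = nseg + 1. *)
Record waypoints (R : realType) : Type := Waypoints {
  nseg : nat;
  wp : 'I_nseg.+1 -> 'rV[R]_3;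
  vels : 'I_nseg.+1 -> {fset 'rV[R]_3};
  vstart : 'rV[R]_3;
  vgoal : 'rV[R]_3;
  vels_start : vels ord0 = [fset vstart]%fset;
  vels_goal : vels ord_max = [fset vgoal]%fset }.

Record vnode (R : realType) (W : waypoints R) : Type := VNode {
  idx : 'I_(nseg W).+1;
  vel : 'rV[R]_3;
  vel_sampled : vel \in vels idx }.

Definition pos (R : realType) (W : waypoints R) (n : vnode W) : 'rV[R]_3 :=
  wp (idx n).

Record vedge (R : realType) (W : waypoints R) : Type := VEdge {
  vsrc : vnode W;
  vtgt : vnode W;
  vedge_next : idx vtgt = (idx vsrc).+1 :> nat }.

Definition velocity_graph (R : realType) (W : waypoints R)
    (umax : 'rV[R]_3) : wgraph R :=
  @WGraph R (vnode W) (vedge W) (@vsrc R W) (@vtgt R W)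
    (fun e => min_time umax (pos (vsrc e)) (vel (vsrc e))
                            (pos (vtgt e)) (vel (vtgt e))).

Definition is_goal (R : realType) (W : waypoints R) (n : vnode W) : Prop :=
  idx n = ord_max /\ vel n = vgoal W.

Definition V_d (R : realType) (W : waypoints R) (umax : 'rV[R]_3)
    (n : vnode W) : \bar R :=
  @cost_to_go R (velocity_graph W umax) [set m | is_goal m] n.

Definition positive_definite (R : realType) (p : nat)
    (q : 'M[R]_(p.+1, 3) -> R) : Prop :=
  q 0 = 0 /\ forall x : 'M[R]_(p.+1, 3), x != 0 -> 0 < q x.

Definition ocp_feasible (R : realType) (p : nat) (c : 'rV[R]_3 -> R)
    (x0 : 'M[R]_(p, 3)) (rf vf : 'rV[R]_3)
    (T : R) (r : nat -> R -> 'rV[R]_3) : Prop :=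
  [/\ 0 <= T,
      integrator_chain p T r,
      ae_on T (fun t => c (r 2%N t) <= 0),
      (forall k : 'I_p, r k 0 = row k x0) &
      r 0%N T = rf /\ r 1%N T = vf].

(* Row k of the argument of q is the k-th derivative of the position, the last
   row (k = p) being the input. *)
Definition ocp_cost (R : realType) (p : nat) (rho : R)
    (q : 'M[R]_(p.+1, 3) -> R) (T : R) (r : nat -> R -> 'rV[R]_3) : \bar R :=
  ((rho * T)%:E +
   \int[@lebesgue_measure R]_(t in `[0%R, T])
      (q (\matrix_(k < p.+1, i < 3) r k t ord0 i))%:E)%E.

Definition ocp_solution (R : realType) (p : nat) (rho : R)
    (c : 'rV[R]_3 -> R) (q : 'M[R]_(p.+1, 3) -> R)
    (x0 : 'M[R]_(p, 3)) (rf vf : 'rV[R]_3)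
    (T : R) (r : nat -> R -> 'rV[R]_3) : Prop :=
  ocp_feasible c x0 rf vf T r /\
  forall (T' : R) (r' : nat -> R -> 'rV[R]_3),
    ocp_feasible c x0 rf vf T' r' ->
    (ocp_cost rho q T r <= ocp_cost rho q T' r')%E.

Record mp_graph (R : realType) (W : waypoints R) (p : nat) (rho : R)
    (c : 'rV[R]_3 -> R) (q : 'M[R]_(p.+1, 3) -> R) : Type := MPGraph {
  mp_node : Type;
  mp_edge : Type;
  mp_src : mp_edge -> mp_node;
  mp_tgt : mp_edge -> mp_node;
  mp_proj : mp_node -> vnode W;
  (* row k is the k-th derivative of the position *)
  mp_state : mp_node -> 'M[R]_(p, 3);
  mp_dur : mp_edge -> R;
  mp_traj : mp_edge -> nat -> R -> 'rV[R]_3;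
  mp_state_pos : forall (n : mp_node) (k : 'I_p),
    k = 0%N :> nat -> row k (mp_state n) = pos (mp_proj n);
  mp_state_vel : forall (n : mp_node) (k : 'I_p),
    k = 1%N :> nat -> row k (mp_state n) = vel (mp_proj n);
  mp_next : forall e : mp_edge,
    idx (mp_proj (mp_tgt e)) = (idx (mp_proj (mp_src e))).+1 :> nat;
  mp_edge_solution : forall e : mp_edge,
    ocp_solution rho c q (mp_state (mp_src e))
      (pos (mp_proj (mp_tgt e))) (vel (mp_proj (mp_tgt e)))
      (mp_dur e) (mp_traj e) }.

Definition mp_wgraph (R : realType) (W : waypoints R) (p : nat) (rho : R)
    (c : 'rV[R]_3 -> R) (q : 'M[R]_(p.+1, 3) -> R)
    (Gmp : mp_graph W rho c q) : wgraph R :=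
  @WGraph R (mp_node Gmp) (mp_edge Gmp) (@mp_src _ _ _ _ _ _ Gmp)
    (@mp_tgt _ _ _ _ _ _ Gmp)
    (fun e => ocp_cost rho q (mp_dur e) (mp_traj e)).

Definition mp_goal (R : realType) (W : waypoints R) (p : nat) (rho : R)
    (c : 'rV[R]_3 -> R) (q : 'M[R]_(p.+1, 3) -> R)
    (Gmp : mp_graph W rho c q) : set (node (mp_wgraph Gmp)) :=
  [set n | is_goal (mp_proj (n : mp_node Gmp))].

Definition is_max_accel (R : realType) (c : 'rV[R]_3 -> R)
    (umax : 'rV[R]_3) : Prop :=
  forall i : 'I_3,
    (exists2 a : 'rV[R]_3, c a <= 0 & `|a ord0 i| = umax ord0 i) /\
    forall a : 'rV[R]_3, c a <= 0 -> `|a ord0 i| <= umax ord0 i.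

(* Main.v *)
Require Import Defs.
From mathcomp Require Import all_boot all_order all_algebra.
From mathcomp Require Import all_classical all_reals all_analysis.

Import Order.TTheory GRing.Theory Num.Theory.
Local Open Scope ring_scope.

(** Forgetting the derivatives of order at least 2 turns a motion primitive of
duration [T] into a feasible trajectory of the double integrator of the same
duration, whose minimum time is therefore at most [T <= rho * T <= J].  Edge by
edge, a path of the motion primitive graph thus projects onto a path of the
velocity graph that costs no more. *)

(** [fn] and [fe] form a graph morphism, so each walk of [H] to a goal has as image a walk of [G] to
    a goal, which competes in the infimum for [fn n]. If no goal is reachable from [n] in [H], the
    right side is [+oo]. *)
Lemma le_cost_to_go_proj (R : realType) (G H : wgraph R)
    (goalG : set (node G)) (goalH : set (node H))
    (fn : node H -> node G) (fe : edge H -> edge G) :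
  (forall e, src (fe e) = fn (src e)) ->
  (forall e, tgt (fe e) = fn (tgt e)) ->
  (forall e, cost (fe e) <= cost e)%E ->
  (forall m, goalH m -> goalG (fn m)) ->
  forall n, (cost_to_go goalG (fn n) <= cost_to_go goalH n)%E.
Proof.
move=> fsrc ftgt fcost fgoal n.
apply: le_ereal_inf_tmp => _ [s [m gm wm] <-].
have walkf : walk (fn n) (map fe s) (fn m).
  elim: s n wm => [|e s IHs] n /=; first by move->.
  by case=> <- /IHs wm; rewrite fsrc ftgt.
apply: (@le_trans _ _ (\sum_(e <- map fe s) cost e)%E).
  apply: ereal_inf_lbound; exists (map fe s) => //.
  by exists (fn m) => //; exact: fgoal.
by rewrite big_map; apply: lee_sum => e _; exact: fcost.
Qed.

(** The same family [r] is the witness: [r 2] is reread as the input of the double integrator, and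
    [is_max_accel] encloses the set where [c] is nonpositive in the box given by [umax]. *)
Lemma ocp_feasible_di_reachable (R : realType) (p : nat) (c : 'rV[R]_3 -> R)
    (umax : 'rV[R]_3) (x0 : 'M[R]_(p, 3)) (r0 v0 rf vf : 'rV[R]_3) (T : R)
    (r : nat -> R -> 'rV[R]_3) :
  (2 <= p)%N ->
  is_max_accel c umax ->
  (forall k : 'I_p, k = 0%N :> nat -> row k x0 = r0) ->
  (forall k : 'I_p, k = 1%N :> nat -> row k x0 = v0) ->
  ocp_feasible c x0 rf vf T r -> di_reachable umax r0 v0 rf vf T.
Proof.
move=> p2 cmax x0r x0v [T0 chain cr init final]; split=> //; exists r.
split=> //.
- by move=> k k2; apply: chain; exact: leq_trans p2.
- move: cr; rewrite /ae_on.
  apply: (@filterS _ _ (ae_filter_ringOfSetsType (@lebesgue_measure R))).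
  by move=> t ct tT i; exact: (cmax i).2 (ct tT).
(* As [2 <= p], position and velocity are rows 0 and 1 of the initial state. *)
- split; first by rewrite (init (Ordinal (ltnW p2))) x0r.
  by rewrite (init (Ordinal p2)) x0v.
Qed.

Lemma le_ocp_cost (R : realType) (p : nat) (rho : R)
    (q : 'M[R]_(p.+1, 3) -> R) (T : R) (r : nat -> R -> 'rV[R]_3) :
  1 <= rho -> (forall x, 0 <= q x) -> 0 <= T -> (T%:E <= ocp_cost rho q T r)%E.
Proof.
move=> rho1 q0 T0; apply: (@le_trans _ _ (rho * T)%:E).
  by rewrite lee_fin ler_peMl.
by rewrite leeDl//; apply: integral_ge0 => t _; rewrite lee_fin.
Qed.

Lemma positive_definite_ge0 (R : realType) (p : nat)
    (q : 'M[R]_(p.+1, 3) -> R) :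
  positive_definite q -> forall x, 0 <= q x.
Proof.
by move=> [q0 qgt0] x; have [->|/qgt0/ltW//] := eqVneq x 0; rewrite q0.
Qed.

Theorem theorem1 (R : realType) (W : waypoints R) (p : nat) (rho : R)
    (c : 'rV[R]_3 -> R) (q : 'M[R]_(p.+1, 3) -> R) (umax : 'rV[R]_3)
    (Gmp : mp_graph W rho c q) :
  (2 <= p)%N ->
  1 < rho ->
  positive_definite q ->
  (forall i : 'I_3, 0 < umax ord0 i) ->
  is_max_accel c umax ->
  @admissible R (mp_wgraph Gmp) (@mp_goal R W p rho c q Gmp)
    (fun n : mp_node Gmp => V_d umax (mp_proj n)).
Proof.
move=> p2 rho1 qpd _ cmax.
pose fe (e : edge (mp_wgraph Gmp)) : edge (velocity_graph W umax) :=
  VEdge (mp_next e).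
(* [mp_proj] respects endpoints and goals by definition, so only the comparison of edge costs
   remains. *)
apply: (@le_cost_to_go_proj R (velocity_graph W umax) (mp_wgraph Gmp)
  _ _ (@mp_proj _ _ _ _ _ _ Gmp) fe) => //= e.
have [feas _] := mp_edge_solution e.
have T0 : 0 <= mp_dur e by case: feas.
have q0 := positive_definite_ge0 _ _ _ qpd.
apply: le_trans (le_ocp_cost _ _ _ _ _ _ (ltW rho1) q0 T0).
(* The minimum time is an infimum of durations, so it suffices that [mp_dur e] is attainable. *)
apply: ereal_inf_lbound; exists (mp_dur e) => //.
apply: ocp_feasible_di_reachable feas => // k k_eq.
- exact: mp_state_pos.
- exact: mp_state_vel.
Qed.
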